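(* Let $P_1$ be the Cantor distribution satisfying $P_1=\frac12P_1\circ S_1^{-1}+\frac12P_1\circ S_2^{-1}$ with $S_1(x)=\frac13x$ and $S_2(x)=\frac13x+\frac13$, let $P_2$ be the discrete distribution with mass $\frac13$ at each point of $D=\{\frac23,\frac56,1\}$, and let $P=\frac12P_1+\frac12P_2$. Let $n\in\mathbb N$ with $n\ge5$, and let $\alpha_n(P)$ be an optimal set of $n$-means for $P$. Then $$\alpha_n(P)=\alpha_{n-3}(P_1)\cup D$$ for some optimal set $\alpha_{n-3}(P_1)$ of $(n-3)$-means for $P_1$, and $$V_n(P)=\tfrac12V_{n-3}(P_1).$$
   Context: $P_1$ is the unique Borel probability measure on $\mathbb R$ satisfying the stated self-similarity relation; its support is the Cantor set in $[0,\frac12]$ generated by $S_1,S_2$. For a Borel probability measure $Q$ on $\mathbb R$ with finite second moment and a finite nonempty set $\alpha\subset\mathbb R$, put $V(Q;\alpha)=\int\min_{a\in\alpha}(x-a)^2\,dQ(x)$. The $n$th quantization error is $V_n(Q)=\inf\{V(Q;\alpha):\alpha\subset\mathbb R,\ 1\le\mathrm{card}(\alpha)\le n\}$. A set $\alpha$ with $1\le\mathrm{card}(\alpha)\le n$ is an optimal set of $n$-means for $Q$ if $V(Q;\alpha)=V_n(Q)$. *)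

(* Defs.v *)
From HB Require Import structures.
From mathcomp Require Import all_boot all_order all_algebra.
From mathcomp Require Import finmap all_classical all_reals all_analysis.
From mathcomp Require Import ring.

Set Implicit Arguments.
Unset Strict Implicit.
Unset Printing Implicit Defensive.

Import Order.TTheory GRing.Theory Num.Theory.

Local Open Scope classical_set_scope.
Local Open Scope ring_scope.

Section quantization.
Context {R : realType}.
Implicit Types (Q : probability R R) (alpha : {fset R}).

(* The minimum is taken in \bar R so that +oo serves as the neutral element;
   it is the real minimum as soon as alpha is nonempty, and the integral is then
   finite whenever Q has a finite second moment. *)
Definition distortion Q alpha : \bar R :=
  (\int[Q]_x \big[mine/+oo]_(a <- alpha) ((x - a) ^+ 2)%:E)%E.

Definition quantization_error Q (n : nat) : \bar R :=
  ereal_inf [set distortion Q alpha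
            | alpha in [set alpha : {fset R} | (1 <= #|` alpha| <= n)%N]].

Definition optimal_means Q (n : nat) alpha : Prop :=
  (1 <= #|` alpha| <= n)%N /\ distortion Q alpha = quantization_error Q n.

End quantization.

Section cantor.
Context {R : realType}.

Definition S1 (x : R) : R := 3^-1 * x.

Definition S2 (x : R) : R := 3^-1 * x + 3^-1.

(* Self-similarity determines a Borel probability measure uniquely, hence a
   predicate rather than a construction. *)
Definition is_cantor_distribution
    (P1 : probability R R) : Prop :=
  forall A : set R, measurable A ->
    (P1 A = 2^-1%:E * P1 (S1 @^-1` A) + 2^-1%:E * P1 (S2 @^-1` A))%E.

End cantor.

Section discrete.
Context {R : realType}.

Definition D : {fset R} := [fset 2 / 3; 5 / 6; 1]%fset.

Definition P2 : set R -> \bar R :=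
  mscale (3^-1)%:nng
    (measure_add (measure_add \d_(2 / 3 : R) \d_(5 / 6 : R)) \d_(1 : R)).

HB.instance Definition _ := Measure.on P2.

Let P2_setT : P2 setT = 1%E.
Proof.
rewrite /P2 /mscale/= /msum !(big_ord_recl, big_ord0)/=.
rewrite /msum !(big_ord_recl, big_ord0)/= !diracT !adde0 -!EFinD -EFinM.
by congr EFin; field.
Qed.

HB.instance Definition _ := @Measure_isProbability.Build _ _ R P2 P2_setT.

End discrete.

Section mixture.
Context {R : realType}.
Variables Q1 Q2 : probability R R.

Definition half_mixture : set R -> \bar R :=
  measure_add (mscale (2^-1)%:nng Q1) (mscale (2^-1)%:nng Q2).

HB.instance Definition _ := Measure.on half_mixture.

Let half_mixture_setT : half_mixture setT = 1%E.
Proof.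
rewrite /half_mixture measure_addE/= /mscale/= !probability_setT !mule1 -EFinD.
by congr EFin => /=; field.
Qed.

HB.instance Definition _ :=
  @Measure_isProbability.Build _ _ R half_mixture half_mixture_setT.

End mixture.

(* Main.v *)
Require Import Defs.
From mathcomp Require Import all_boot all_order all_algebra.
From mathcomp Require Import finmap all_classical all_reals all_analysis measurable_realfun.
From mathcomp Require Import ring lra.

Set Implicit Arguments.
Unset Strict Implicit.
Unset Printing Implicit Defensive.

Import Order.TTheory GRing.Theory Num.Theory.

Local Open Scope classical_set_scope.
Local Open Scope ring_scope.

(* Write W for V_(n-3)(P1), so that an optimal alpha for P satisfies
   V(P1; alpha) + V(P2; alpha) <= W <= V_2(P1) = 1/288.  Since V(P2; alpha) is
   this small, the points d1, d2, d3 of alpha nearest to 2/3, 5/6, 1 are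
   distinct.  If alpha has a point b < d1 with b + d1 >= 1, then d1, d2, d3 are
   useless on [0, 1/2], so removing them gives a set A of at most n - 3 points
   with W <= V(P1; A) <= V(P1; alpha), which forces V(P2; alpha) = 0 and the
   optimality of A.  Otherwise alpha misses ]1/3 + t, 2/3 - t[, where
   t = max(0, 2/3 - d1), which costs at least t^2/3 in V(P2; alpha); bounding the
   distance to alpha on a few cylinders of the Cantor set then shows that
   V(P1; alpha) + t^2/3 exceeds V_3(P1), hence W if n >= 6, and, when only two
   points are left for P1, that it exceeds V_2(P1). *)

(** * Integrals against the mixture and [P2]; measurability of the similarities *)

Section integrals.
Context {R : realType}.
Implicit Types (Q : probability R R) (f : R -> \bar R).

Lemma ge0_integral_half_mixture (Q1 Q2 : probability R R) f :
  measurable_fun [set: R] f -> (forall x, 0 <= f x)%E ->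
  (\int[half_mixture Q1 Q2]_x f x =
   2^-1%:E * \int[Q1]_x f x + 2^-1%:E * \int[Q2]_x f x)%E.
Proof.
move=> mf f0; rewrite ge0_integral_measure_add//.
by rewrite !ge0_integral_mscale.
Qed.

Lemma ge0_integral_P2 f :
  measurable_fun [set: R] f -> (forall x, 0 <= f x)%E ->
  (\int[P2]_x f x = 3^-1%:E * (f (2 / 3)%R + f (5 / 6)%R + f 1%R))%E.
Proof.
move=> mf f0; rewrite ge0_integral_mscale//; congr (_ * _)%E.
rewrite ge0_integral_measure_add// ge0_integral_measure_add//.
by rewrite !integral_dirac// !diracT !mul1e.
Qed.

Lemma measurable_S1 : measurable_fun [set: R] (@S1 R).
Proof. exact: measurable_funM. Qed.

Lemma measurable_S2 : measurable_fun [set: R] (@S2 R).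
Proof. by apply: measurable_funD => //; exact: measurable_funM. Qed.

(** As 1/4 is the midpoint of [0, 1/2], these sets are the outside of that interval widened by [s]
    on each side. *)
Lemma measurable_tail (s : R) :
  measurable [set x : R | (`|x - 4^-1| > 4^-1 + s)%R].
Proof.
rewrite (_ : [set x | _] = (fun x => `|x - 4^-1|) @^-1` `]4^-1 + s, +oo[).
  rewrite -[X in measurable X]setTI; apply: measurableT_comp => //.
  exact: measurable_funB.
by apply/seteqP; split => x /=; rewrite in_itv/= andbT.
Qed.

End integrals.

(** * Self-similarity of integrals and support of the Cantor distribution *)

Section cantor.
Context {R : realType}.
Variable P1 : probability R R.
Hypothesis hP1 : is_cantor_distribution P1.
Implicit Types f g : R -> \bar R.

(** By [hP1], [P1] is half the sum of its pushforwards under [S1] and [S2]; a change of variables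
    carries this over to integrals. *)
Lemma ge0_integral_cantor f :
  measurable_fun [set: R] f -> (forall x, 0 <= f x)%E ->
  (\int[P1]_x f x =
   2^-1%:E * \int[P1]_x f (S1 x) + 2^-1%:E * \int[P1]_x f (S2 x))%E.
Proof.
move=> mf f0.
have mS1 := @measurable_S1 R; have mS2 := @measurable_S2 R.
rewrite (@eq_measure_integral _ _ _ _
  (measure_add (mscale (2^-1)%:nng (pushforward P1 (@S1 R)))
               (mscale (2^-1)%:nng (pushforward P1 (@S2 R))))); last first.
  move=> A mA _; rewrite [RHS]measure_addE; exact: hP1.
rewrite ge0_integral_measure_add// !ge0_integral_mscale//.
by rewrite !ge0_integral_pushforward// !preimage_setT.
Qed.

(* |S1 x - 1/4| and |S2 x - 1/4| are at most |x - 1/4| / 3 + 1/6. *)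
Lemma cantor_tail_le (r : R) :
  (P1 [set x | (`|x - 4^-1| > 4^-1 + r)%R]
     <= P1 [set x | (`|x - 4^-1| > 4^-1 + r * 3)%R])%E.
Proof.
have mB s := @measurable_tail R s.
rewrite hP1//.
have le1 (S : R -> R) : measurable_fun [set: R] S ->
    (forall x, 4^-1 + r < `|S x - 4^-1| -> 4^-1 + r * 3 < `|x - 4^-1|) ->
    (P1 (S @^-1` [set x | (`|x - 4^-1| > 4^-1 + r)%R])
     <= P1 [set x | (`|x - 4^-1| > 4^-1 + r * 3)%R])%E.
  move=> mS hS; apply: le_measure; rewrite ?inE//.
  by rewrite -[X in measurable X]setTI; exact: mS.
apply: (@le_trans _ _ (2^-1%:E * P1 [set x | (`|x - 4^-1| > 4^-1 + r * 3)%R] +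
                       2^-1%:E * P1 [set x | (`|x - 4^-1| > 4^-1 + r * 3)%R])%E).
  apply: leeD; (apply: lee_wpmul2l; first by rewrite lee_fin invr_ge0); apply: le1.
  - exact: measurable_S1.
  - by move=> x; rewrite /S1 !lter_normr => /orP[] h; apply/orP; [left|right]; lra.
  - exact: measurable_S2.
  - by move=> x; rewrite /S2 !lter_normr => /orP[] h; apply/orP; [left|right]; lra.
rewrite -ge0_muleDl ?lee_fin// -EFinD.
by rewrite (_ : 2^-1 + 2^-1 = 1 :> R) ?mul1e//; lra.
Qed.

(** Iterating [cantor_tail_le] bounds the mass beyond distance 1/4 + r by the mass beyond 1/4 + r
    3^k for every k. Those sets decrease to the empty set, so the mass is 0; the radii r = 1/(k+1)
    then exhaust the complement of [0, 1/2]. *)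
Lemma cantor_support : P1.-negligible [set x | (`|x - 4^-1| > 4^-1)%R].
Proof.
have mB s := @measurable_tail R s.
have tail0 (r : R) : 0 < r -> P1 [set x | (`|x - 4^-1| > 4^-1 + r)%R] = 0%E.
  move=> r0; apply/eqP; rewrite eq_le measure_ge0 andbT.
  pose F k := [set x : R | (`|x - 4^-1| > 4^-1 + r * 3 ^+ k)%R].
  have F0 : \bigcap_k F k = set0.
    apply/seteqP; split => // x; rewrite /bigcap /F /= => h.
    (* An integer k above |x - 1/4| / r suffices, because k <= 3^k. *)
    have := h (Num.bound (`|x - 4^-1| / r)) I; apply/negP; rewrite -leNgt.
    have := archi_boundP (divr_ge0 (normr_ge0 (x - 4^-1)) (ltW r0)).
    rewrite ltr_pdivrMr// => /ltW/le_trans -> //.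
    rewrite mulrC -[leLHS]add0r lerD ?ler_wpM2l//; first by rewrite ltW.
    by rewrite -natrX ler_nat ltnW// ltn_expl.
  have cvgF : ((P1 \o F) x @[x --> \oo] --> P1 (\bigcap_k F k))%classic.
    apply: nonincreasing_cvg_mu => //.
    - by apply: le_lt_trans (ltry 1); apply: probability_le1; exact: mB.
    - by move=> k; exact: mB.
    - by rewrite F0.
    move=> m n mn; apply/subsetPset => x; rewrite /F /=; apply: le_lt_trans.
    rewrite lerD2l; apply: ler_wpM2l; first exact: ltW.
    by apply: ler_weXn2l => //; rewrite ler1n.
  rewrite F0 measure0 in cvgF.
  rewrite -(cvg_lim _ cvgF)//; apply: lime_ge; first exact: cvgP cvgF.
  apply: nearW; elim => [|k IHk]; first by rewrite /F /= expr0 mulr1.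
  by rewrite (le_trans IHk)// /F /= exprSr mulrA; exact: cantor_tail_le.
have -> : [set x : R | (`|x - 4^-1| > 4^-1)%R] =
    \bigcup_k [set x : R | (`|x - 4^-1| > 4^-1 + k.+1%:R^-1)%R].
  apply/seteqP; split => [x /= xgt|x [k _] /=]; last first.
    by apply: le_lt_trans; rewrite lerDl.
  have /ltr_add_invr[k hk] : 4^-1 < `|x - 4^-1| by [].
  by exists k.
apply: negligible_bigcup => k; apply/negligibleP; first exact: mB.
by apply: tail0.
Qed.

(** The complement of [0, 1/2] is null, so pointwise estimates are only ever required on that
    interval. *)
Lemma ge0_le_integral_cantor f g :
  measurable_fun [set: R] f -> (forall x, 0 <= f x)%E ->
  measurable_fun [set: R] g -> (forall x, 0 <= g x)%E ->
  (forall x, 0 <= x -> x <= 2^-1 -> (f x <= g x)%E) ->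
  (\int[P1]_x f x <= \int[P1]_x g x)%E.
Proof.
move=> mf f0 mg g0 fg; apply: ae_ge0_le_integral => //.
apply: negligibleS cantor_support => x /= /not_implyP[_ nfg].
rewrite ltNge; apply/negP; rewrite ler_norml => /andP[h1 h2].
by apply: nfg; apply: fg; lra.
Qed.

Lemma integral_cantor_ge (c : R) g :
  measurable_fun [set: R] g -> (forall x, 0 <= g x)%E -> 0 <= c ->
  (forall x, 0 <= x -> x <= 2^-1 -> (c%:E <= g x)%E) ->
  (c%:E <= \int[P1]_x g x)%E.
Proof.
move=> mg g0 c0 cg.
have <- : (\int[P1]_x (cst c%:E x) = c%:E)%E.
  by rewrite integral_cst// [X in (_ * X)%E](probability_setT P1) mule1.
by apply: ge0_le_integral_cantor.
Qed.

Lemma integral_cantor_le (c : R) g :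
  measurable_fun [set: R] g -> (forall x, 0 <= g x)%E -> 0 <= c ->
  (forall x, 0 <= x -> x <= 2^-1 -> (g x <= c%:E)%E) ->
  (\int[P1]_x g x <= c%:E)%E.
Proof.
move=> mg g0 c0 cg.
have <- : (\int[P1]_x (cst c%:E x) = c%:E)%E.
  by rewrite integral_cst// [X in (_ * X)%E](probability_setT P1) mule1.
by apply: ge0_le_integral_cantor.
Qed.

End cantor.

(** * Distortion, quantization error, and the upper bound for the mixture *)

Section distortion.
Context {R : realType}.
Implicit Types (Q : probability R R) (alpha beta : {fset R}).

Definition sqdist alpha (x : R) : \bar R :=
  \big[mine/+oo%E]_(a <- alpha) ((x - a) ^+ 2)%:E.

Lemma sqdist_ge0 alpha x : (0 <= sqdist alpha x)%E.
Proof. by apply: le_bigmin => [|a _]; rewrite ?leey// lee_fin sqr_ge0. Qed.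

Lemma measurable_sqr_sub (a : R) :
  measurable_fun [set: R] (fun x : R => ((x - a) ^+ 2)%:E).
Proof.
apply/measurable_EFinP; apply: measurable_funX.
exact: measurable_funB.
Qed.

Lemma measurable_sqdist alpha : measurable_fun [set: R] (sqdist alpha).
Proof.
rewrite /sqdist; elim: (enum_fset alpha) => [|a s IHs].
  by under eq_fun do rewrite big_nil; exact: measurable_cst.
under eq_fun do rewrite big_cons.
by apply: measurable_mine => //; exact: measurable_sqr_sub.
Qed.

Lemma sqdist_le alpha a x : a \in alpha -> (sqdist alpha x <= ((x - a) ^+ 2)%:E)%E.
Proof. by move=> aalpha; exact: ge_bigmin_seq. Qed.

Lemma sqdist_ge alpha (c : \bar R) x :
  (forall a, a \in alpha -> (c <= ((x - a) ^+ 2)%:E)%E) -> (c <= sqdist alpha x)%E.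
Proof.
move=> h; rewrite /sqdist big_seq_cond.
by apply: le_bigmin => [|a /andP[? _]]; rewrite ?leey//; exact: h.
Qed.

Lemma sqdist_attained alpha x : (0 < #|` alpha|)%N ->
  exists2 a, a \in alpha & sqdist alpha x = ((x - a) ^+ 2)%:E.
Proof.
suff H (s : seq R) : (0 < size s)%N -> exists2 a, a \in s &
    \big[mine/+oo%E]_(a <- s) ((x - a) ^+ 2)%:E = ((x - a) ^+ 2)%:E.
  exact: H.
(* The induction starts at one-element lists: on the empty list the minimum is the default [+oo],
   which no point attains. *)
elim: s => // a [|b s] IHs _.
  by exists a; rewrite ?inE// big_seq1.
have [//|c cs Ec] := IHs; rewrite big_cons Ec.
have [ac|ca] := leP ((x - a) ^+ 2)%:E ((x - c) ^+ 2)%:E.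
  by exists a; rewrite ?mem_head.
by exists c; rewrite // inE cs orbT.
Qed.

Lemma distortion_ge0 Q alpha : (0 <= distortion Q alpha)%E.
Proof. by apply: integral_ge0 => x _; exact: sqdist_ge0. Qed.

Lemma distortionS Q alpha beta : (alpha `<=` beta)%fset ->
  (distortion Q beta <= distortion Q alpha)%E.
Proof.
move=> /fsubsetP ab; apply: (@ge0_le_integral _ _ _ Q setT _ (sqdist _) (sqdist _)) => //.
- by move=> x _; exact: sqdist_ge0.
- exact: measurable_sqdist.
- exact: measurable_sqdist.
- by move=> x _; apply: sqdist_ge => a /ab; exact: sqdist_le.
Qed.

Lemma distortion_half_mixture (Q1 Q2 : probability R R) alpha :
  (distortion (half_mixture Q1 Q2) alpha =
   2^-1%:E * distortion Q1 alpha + 2^-1%:E * distortion Q2 alpha)%E.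
Proof.
rewrite /distortion ge0_integral_half_mixture//.
- exact: measurable_sqdist.
- exact: sqdist_ge0.
Qed.

(** The witnesses are points of [alpha] nearest to 2/3, 5/6 and 1; at this stage they may
    coincide. *)
Lemma distortion_P2 alpha : (0 < #|` alpha|)%N ->
  exists d1 d2 d3, [/\ d1 \in alpha, d2 \in alpha, d3 \in alpha &
    distortion P2 alpha =
      (3^-1 * ((2 / 3 - d1) ^+ 2 + (5 / 6 - d2) ^+ 2 + (1 - d3) ^+ 2))%:E].
Proof.
move=> alpha0.
have [d1 d1a E1] := sqdist_attained (2 / 3) alpha0.
have [d2 d2a E2] := sqdist_attained (5 / 6) alpha0.
have [d3 d3a E3] := sqdist_attained 1 alpha0.
exists d1, d2, d3; split => //.
transitivity (3^-1%:E * (sqdist alpha (2 / 3) + sqdist alpha (5 / 6) +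
  sqdist alpha 1))%E; last by rewrite E1 E2 E3.
rewrite /distortion ge0_integral_P2//.
- exact: measurable_sqdist.
- exact: sqdist_ge0.
Qed.

Lemma quantization_error_le Q n alpha : (1 <= #|` alpha| <= n)%N ->
  (quantization_error Q n <= distortion Q alpha)%E.
Proof. by move=> h; apply: ereal_inf_lbound; exists alpha. Qed.

Lemma quantization_error_ge Q n (c : \bar R) :
  (forall alpha, (1 <= #|` alpha| <= n)%N -> (c <= distortion Q alpha)%E) ->
  (c <= quantization_error Q n)%E.
Proof. by move=> h; apply: le_ereal_inf_tmp => _ [alpha halpha <-]; exact: h. Qed.

(** Adding [D] to any competitor of at most n - 3 points makes the [P2] part vanish and does not
    increase the [Q] part. *)
Lemma quantization_error_half_mixture_P2 Q n : (4 <= n)%N ->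
  (quantization_error (half_mixture Q P2) n <=
   2^-1%:E * quantization_error Q (n - 3))%E.
Proof.
move=> n4; rewrite lee_pdivlMl//.
apply: quantization_error_ge => beta /andP[beta0 betan].
have betaD : (1 <= #|` (beta `|` D)%fset| <= n)%N.
  have D3 : (#|` @D R| <= 3)%N.
    rewrite /D !cardfsU !cardfs1 (leq_trans (leq_subr _ _))//.
    by rewrite -[leqRHS]/(2 + 1)%N leq_add2r leq_subr.
  rewrite (leq_trans beta0) ?fsubset_leq_card ?fsubsetUl//=.
  rewrite cardfsU (leq_trans (leq_subr _ _))//.
  by rewrite (leq_trans (leq_add betan D3))// subnK// ltnW.
rewrite -lee_pdivlMl//.
rewrite (le_trans (quantization_error_le _ betaD))//.
rewrite distortion_half_mixture.
have -> : distortion P2 (beta `|` D)%fset = 0%E.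
  rewrite /distortion ge0_integral_P2; last 2 first.
  - exact: measurable_sqdist.
  - exact: sqdist_ge0.
  have sqD0 (d : R) : d \in D -> sqdist (beta `|` D)%fset d = 0%E.
    move=> dD; apply/eqP; rewrite eq_le sqdist_ge0 andbT.
    have dU : d \in (beta `|` D)%fset by rewrite inE dD orbT.
    by rewrite (le_trans (sqdist_le _ dU))// subrr expr0n.
  rewrite -/(sqdist _ (2 / 3)) -/(sqdist _ (5 / 6)) -/(sqdist _ 1).
  by rewrite !sqD0 ?adde0 ?mule0// !inE eqxx ?orbT.
rewrite mule0 adde0 lee_wpmul2l// ?lee_fin ?invr_ge0//.
by apply: distortionS; exact: fsubsetUl.
Qed.

End distortion.

(** * Variance of the Cantor distribution and splitting into halves *)

Section cantor.
Context {R : realType}.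
Variable P1 : probability R R.
Hypothesis hP1 : is_cantor_distribution P1.
Implicit Types f g : R -> \bar R.

(** Self-similarity gives the second moment F about 1/4 the equation F = F/9 + 1/36, whose only
    finite solution is 1/32. *)
Lemma integral_cantor_variance (c : R) : 0 <= c ->
  (\int[P1]_x (c * (x - 4^-1) ^+ 2)%:E = (c / 32)%:E)%E.
Proof.
move=> c0.
under eq_integral do rewrite EFinM.
rewrite ge0_integralZl_EFin//; last 2 first.
- by move=> x _; rewrite lee_fin sqr_ge0.
- exact: measurable_sqr_sub.
set F := (\int[P1]_x _)%E; suff -> : F = (32^-1)%:E by [].
have F0 : (0 <= F)%E by apply: integral_ge0 => x _; rewrite lee_fin sqr_ge0.
(* Finiteness comes first, since [+oo] also solves the equation below. *)
have Ffin : F \is a fin_num.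
  rewrite ge0_fin_numE//; apply: le_lt_trans (ltry 1).
  apply: (integral_cantor_le hP1) => //.
  - exact: measurable_sqr_sub.
  - by move=> x; rewrite lee_fin sqr_ge0.
  - by move=> x x0 x1; rewrite lee_fin; nra.
(* The two images of x - 1/4 are (x - 1/4) / 3 -+ 1/6. *)
have : F = ((9^-1)%:E * F + (36^-1)%:E)%E.
  rewrite {1}/F ge0_integral_cantor//; last 2 first.
  - exact: measurable_sqr_sub.
  - by move=> x; rewrite lee_fin sqr_ge0.
  rewrite -ge0_muleDr; [|by apply: integral_ge0 => x _; rewrite lee_fin sqr_ge0..].
  have mS (S : R -> R) : measurable_fun [set: R] S ->
      measurable_fun [set: R] (fun x => ((S x - 4^-1) ^+ 2)%:E).
    by move=> mS; apply: (measurableT_comp (measurable_sqr_sub _)).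
  rewrite -ge0_integralD//; last 4 first.
  - by move=> x _; rewrite lee_fin sqr_ge0.
  - exact: mS measurable_S1.
  - by move=> x _; rewrite lee_fin sqr_ge0.
  - exact: mS measurable_S2.
  (* The cross terms of the two squares cancel. *)
  transitivity (2^-1%:E * \int[P1]_x (((2 / 9)%:E * ((x - 4^-1) ^+ 2)%:E) + 18^-1%:E))%E.
    congr (_ * _)%E; apply: eq_integral => x _.
    by rewrite -EFinM -!EFinD /S1 /S2; congr EFin; field.
  rewrite ge0_integralD//; last 2 first.
  - by move=> x _; rewrite -EFinM lee_fin mulr_ge0// sqr_ge0.
  - by apply: measurable_funeM; exact: measurable_sqr_sub.
  rewrite ge0_integralZl_EFin//; last 2 first.
  - by move=> x _; rewrite lee_fin sqr_ge0.
  - exact: measurable_sqr_sub.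
  rewrite -/F integral_cst// [X in (_ + _ * X)%E](probability_setT P1) mule1.
  rewrite -(fineK Ffin) -!(EFinM, EFinD); congr EFin; field => //.
have [r ->] : exists r : R, F = r%:E by exists (fine F); rewrite fineK.
rewrite -EFinM -EFinD => -[h]; congr EFin; lra.
Qed.

Lemma integral_cantor_ge_halves (c1 c2 : R) f :
  measurable_fun [set: R] f -> (forall x, 0 <= f x)%E ->
  (c1%:E <= \int[P1]_x f (S1 x))%E -> (c2%:E <= \int[P1]_x f (S2 x))%E ->
  (((c1 + c2) / 2)%:E <= \int[P1]_x f x)%E.
Proof.
move=> mf f0 h1 h2; rewrite ge0_integral_cantor//.
rewrite (_ : (c1 + c2) / 2 = 2^-1 * c1 + 2^-1 * c2); last by field.
by rewrite EFinD !EFinM leeD// lee_wpmul2l// lee_fin invr_ge0.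
Qed.

Lemma integral_cantor_le_halves (c1 c2 : R) f :
  measurable_fun [set: R] f -> (forall x, 0 <= f x)%E ->
  (\int[P1]_x f (S1 x) <= c1%:E)%E -> (\int[P1]_x f (S2 x) <= c2%:E)%E ->
  (\int[P1]_x f x <= ((c1 + c2) / 2)%:E)%E.
Proof.
move=> mf f0 h1 h2; rewrite ge0_integral_cantor//.
rewrite (_ : (c1 + c2) / 2 = 2^-1 * c1 + 2^-1 * c2); last by field.
by rewrite EFinD !EFinM leeD// lee_wpmul2l// lee_fin invr_ge0.
Qed.
End cantor.

(** * Upper bounds for V_2 and V_3, and lower bounds through cylinders *)

Section cantor_bounds.
Context {R : realType}.
Variable P1 : probability R R.
Hypothesis hP1 : is_cantor_distribution P1.
Implicit Types alpha : {fset R}.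

Lemma measurable_sqdist_comp alpha (S : R -> R) :
  measurable_fun [set: R] S -> measurable_fun [set: R] (fun x => sqdist alpha (S x)).
Proof. by move=> mS; apply: (measurableT_comp (measurable_sqdist _)). Qed.

(** Meant for a composition [S] of [S1] and [S2], with [a] the image of 1/4 and [c] the squared
    contraction ratio: the cylinder is served by its own mean. *)
Lemma integral_sqdist_le alpha (S : R -> R) (a c : R) :
  measurable_fun [set: R] S -> a \in alpha -> 0 <= c ->
  (forall x, (S x - a) ^+ 2 = c * (x - 4^-1) ^+ 2) ->
  (\int[P1]_x sqdist alpha (S x) <= (c / 32)%:E)%E.
Proof.
move=> mS aalpha c0 hS; rewrite -(integral_cantor_variance hP1)//.
apply: ge0_le_integral => //.
- by move=> x _; exact: sqdist_ge0.
- exact: measurable_sqdist_comp.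
- apply/measurable_EFinP/measurable_funM => //; apply: measurable_funX.
  exact: measurable_funB.
- by move=> x _; rewrite -hS; exact: sqdist_le.
Qed.

Lemma cantor_quantization_error2 n : (2 <= n)%N ->
  (quantization_error P1 n <= (288^-1)%:E)%E.
Proof.
move=> n2; pose alpha : {fset R} := [fset 12^-1; 5 / 12]%fset.
have halpha : (1 <= #|` alpha| <= n)%N.
  by rewrite /alpha cardfs2/= (leq_trans _ n2)// ltnS leq_b1.
apply: le_trans (quantization_error_le _ halpha) _.
rewrite (_ : 288^-1 = (9^-1 / 32 + 9^-1 / 32) / 2); last by field.
apply: integral_cantor_le_halves => //.
- exact: measurable_sqdist.
- exact: sqdist_ge0.
- apply: (@integral_sqdist_le _ _ (12^-1)); rewrite ?inE ?eqxx//.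
  + exact: measurable_S1.
  + by move=> x; rewrite /S1; field.
- apply: (@integral_sqdist_le _ _ (5 / 12)); rewrite ?inE ?eqxx ?orbT//.
  + exact: measurable_S2.
  + by move=> x; rewrite /S2; field.
Qed.

Lemma cantor_quantization_error3 n : (3 <= n)%N ->
  (quantization_error P1 n <= (5 / 2592)%:E)%E.
Proof.
(* The points are S1(1/4), S2(S1(1/4)) and S2(S2(1/4)): the right half is split once more. *)
move=> n3; pose alpha : {fset R} := [fset 12^-1; 13 / 36; 17 / 36]%fset.
have halpha : (1 <= #|` alpha| <= n)%N.
  rewrite cardfs_gt0; apply/andP; split.
    by apply/fset0Pn; exists (12^-1); rewrite !inE eqxx.
  rewrite (leq_trans _ n3)// /alpha !cardfsU !cardfs1 (leq_trans (leq_subr _ _))//.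
  by rewrite -[leqRHS]/(2 + 1)%N leq_add2r leq_subr.
apply: le_trans (quantization_error_le _ halpha) _.
rewrite (_ : 5 / 2592 = (9^-1 / 32 + (81^-1 / 32 + 81^-1 / 32) / 2) / 2); last by field.
have mS1 := @measurable_S1 R; have mS2 := @measurable_S2 R.
apply: integral_cantor_le_halves => //.
- exact: measurable_sqdist.
- exact: sqdist_ge0.
- apply: (@integral_sqdist_le _ _ (12^-1)); rewrite ?inE ?eqxx//.
  by move=> x; rewrite /S1; field.
apply: (integral_cantor_le_halves hP1 (f := fun x => sqdist alpha (S2 x))) => //.
- exact: measurable_sqdist_comp.
- by move=> x; exact: sqdist_ge0.
- apply: (@integral_sqdist_le _ (fun x => S2 (S1 x)) (13 / 36)); rewrite ?inE ?eqxx ?orbT//.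
  + exact: (measurableT_comp mS2).
  + by move=> x; rewrite /S2 /S1; field.
- apply: (@integral_sqdist_le _ (fun x => S2 (S2 x)) (17 / 36)); rewrite ?inE ?eqxx ?orbT//.
  + exact: (measurableT_comp mS2).
  + by move=> x; rewrite /S2; field.
Qed.

Lemma integral_sqdist_ge alpha (S : R -> R) (c l u : R) :
  measurable_fun [set: R] S -> 0 <= c ->
  (forall x, 0 <= x -> x <= 2^-1 -> l <= S x /\ S x <= u) ->
  (forall a x, a \in alpha -> l <= x -> x <= u -> c <= (x - a) ^+ 2) ->
  (c%:E <= \int[P1]_x sqdist alpha (S x))%E.
Proof.
move=> mS c0 Slu hc; apply: (integral_cantor_ge hP1) => //.
- exact: measurable_sqdist_comp.
- by move=> x; exact: sqdist_ge0.
move=> x x0 x1; have [lS Su] := Slu _ x0 x1.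
by apply: sqdist_ge => a aalpha; rewrite lee_fin; exact: hc.
Qed.

(** Indices are the words of the cylinders: 122 stands for the image of [0, 1/2] under S1 S2 S2,
    which is contained in [4/27, 1/6]. Words of length 3 have mass 1/8, and 21 has mass 1/4. *)
Lemma cantor_distortion_ge alpha (c111 c122 c21 c221 c222 : R) :
  [/\ 0 <= c111, 0 <= c122, 0 <= c21, 0 <= c221 & 0 <= c222] ->
  (forall a x, a \in alpha -> 0 <= x -> x <= 54^-1 -> c111 <= (x - a) ^+ 2) ->
  (forall a x, a \in alpha -> 4 / 27 <= x -> x <= 6^-1 -> c122 <= (x - a) ^+ 2) ->
  (forall a x, a \in alpha -> 3^-1 <= x -> x <= 7 / 18 -> c21 <= (x - a) ^+ 2) ->
  (forall a x, a \in alpha -> 4 / 9 <= x -> x <= 25 / 54 -> c221 <= (x - a) ^+ 2) ->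
  (forall a x, a \in alpha -> 13 / 27 <= x -> x <= 2^-1 -> c222 <= (x - a) ^+ 2) ->
  (((c111 + c122 + 2 * c21 + c221 + c222) / 8)%:E <= distortion P1 alpha)%E.
Proof.
move=> [p111 p122 p21 p221 p222] h111 h122 h21 h221 h222.
have mS1 := @measurable_S1 R; have mS2 := @measurable_S2 R.
have halves (S : R -> R) (c1 c2 : R) : measurable_fun [set: R] S ->
    (c1%:E <= \int[P1]_x sqdist alpha (S (S1 x)))%E ->
    (c2%:E <= \int[P1]_x sqdist alpha (S (S2 x)))%E ->
    (((c1 + c2) / 2)%:E <= \int[P1]_x sqdist alpha (S x))%E.
  move=> mS; apply: (integral_cantor_ge_halves hP1 (f := fun x => sqdist alpha (S x))).
    exact: measurable_sqdist_comp.
  by move=> x; exact: sqdist_ge0.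
have mc (S T : R -> R) : measurable_fun [set: R] S -> measurable_fun [set: R] T ->
    measurable_fun [set: R] (fun x => S (T x)).
  by move=> mS mT; exact: (measurableT_comp mS).
have sq0 a x : a \in alpha -> True -> True -> 0 <= (x - a) ^+ 2 :> R by rewrite sqr_ge0.
(* The two zeros are the trivial bounds on the cylinders 112 and 121. *)
rewrite (_ : (_ / 8) = (((c111 + 0) / 2 + (0 + c122) / 2) / 2 +
                        (c21 + (c221 + c222) / 2) / 2) / 2); last by field.
apply: (halves id); first exact: measurable_id.
- apply: (halves S1) => //;
    [apply: (halves (fun x => S1 (S1 x)))|apply: (halves (fun x => S1 (S2 x)))];
    try exact: mc.
  + apply: (@integral_sqdist_ge _ (fun x => S1 (S1 (S1 x))) _ 0 (54^-1)) => //.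
      exact: (mc _ _ mS1 (mc _ _ mS1 mS1)).
    by move=> x x0 x1; rewrite /S1; split; lra.
  + by apply: integral_ge0 => x _; exact: sqdist_ge0.
  + by apply: integral_ge0 => x _; exact: sqdist_ge0.
  + apply: (@integral_sqdist_ge _ (fun x => S1 (S2 (S2 x))) _ (4 / 27) (6^-1)) => //.
      exact: (mc _ _ mS1 (mc _ _ mS2 mS2)).
    by move=> x x0 x1; rewrite /S1 /S2; split; lra.
- apply: (halves S2) => //; last apply: (halves (fun x => S2 (S2 x))); try exact: mc.
  + apply: (@integral_sqdist_ge _ (fun x => S2 (S1 x)) _ (3^-1) (7 / 18)) => //.
      exact: mc.
    by move=> x x0 x1; rewrite /S1 /S2; split; lra.
  + apply: (@integral_sqdist_ge _ (fun x => S2 (S2 (S1 x))) _ (4 / 9) (25 / 54)) => //.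
      exact: (mc _ _ mS2 (mc _ _ mS2 mS1)).
    by move=> x x0 x1; rewrite /S1 /S2; split; lra.
  + apply: (@integral_sqdist_ge _ (fun x => S2 (S2 (S2 x))) _ (13 / 27) (2^-1)) => //.
      exact: (mc _ _ mS2 (mc _ _ mS2 mS2)).
    by move=> x x0 x1; rewrite /S2; split; lra.
Qed.

End cantor_bounds.

(** * Lower bounds when the means avoid a gap around 1/2 *)

Section gap.
Context {R : realType}.
Variable P1 : probability R R.
Hypothesis hP1 : is_cantor_distribution P1.
Implicit Types alpha : {fset R}.

Lemma sqr_ge_gap (c x a : R) : 0 <= c -> a <= x - c \/ x + c <= a ->
  c ^+ 2 <= (x - a) ^+ 2.
Proof. by move=> c0 [h|h]; nra. Qed.

(** Cylinders 221 and 222 start at 4/9 and 13/27, that is 1/9 - t and 4/27 - t beyond the left end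
    of the gap; its right end is at least as far from them. *)
Lemma cantor_gap_distortion alpha (t c111 c122 c21 : R) :
  0 <= t <= 9^-1 -> [/\ 0 <= c111, 0 <= c122 & 0 <= c21] ->
  (forall a, a \in alpha -> a <= 3^-1 + t \/ 2 / 3 - t <= a) ->
  (forall a x, a \in alpha -> 0 <= x -> x <= 54^-1 -> c111 <= (x - a) ^+ 2) ->
  (forall a x, a \in alpha -> 4 / 27 <= x -> x <= 6^-1 -> c122 <= (x - a) ^+ 2) ->
  (forall a x, a \in alpha -> 3^-1 <= x -> x <= 7 / 18 -> c21 <= (x - a) ^+ 2) ->
  (((c111 + c122 + 2 * c21 + (9^-1 - t) ^+ 2 + (4 / 27 - t) ^+ 2) / 8)%:E
    <= distortion P1 alpha)%E.
Proof.
move=> /andP[t0 t1] [p111 p122 p21] ha h111 h122 h21.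
apply: cantor_distortion_ge => //; first by rewrite !sqr_ge0.
- move=> a x /ha h x0 x1; apply: sqr_ge_gap; first lra.
  by case: h => h; [left|right]; lra.
- move=> a x /ha h x0 x1; apply: sqr_ge_gap; first lra.
  by case: h => h; [left|right]; lra.
Qed.

Lemma cantor_gap alpha (t : R) : 0 <= t <= 9^-1 ->
  (forall a, a \in alpha -> a <= 3^-1 + t \/ 2 / 3 - t <= a) ->
  exists2 v : R, (v%:E <= distortion P1 alpha)%E & 5 / 2592 < v + 3^-1 * t ^+ 2.
Proof.
move=> t01 ha; eexists.
  by apply: (@cantor_gap_distortion _ t 0 0 0) => // *; rewrite sqr_ge0.
(* The left-out terms being 0, the quadratic in t is least at t = 1/18, with value 29/11664, above
   5/2592 = 22.5/11664. *)
by have := sqr_ge0 (t - 18^-1); lra.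
Qed.

(* Two points left of 4/9 cannot serve [0, 1/18], [1/9, 1/6] and [1/3, 7/18] at
   once: the last disjunction covers every pair, according to whether one of
   them exceeds 13/50, a value at which both cases still beat 1/288. *)
Lemma cantor_gap_two_means alpha (t : R) : 0 <= t <= 9^-1 ->
  (forall a, a \in alpha -> a <= 3^-1 + t \/ 2 / 3 - t <= a) ->
  (forall a, a \in alpha -> a <= 13 / 50 \/ 5 / 9 <= a) \/
    (exists u, forall a, a \in alpha -> a = u \/ 13 / 50 < a) ->
  exists2 v : R, (v%:E <= distortion P1 alpha)%E & 288^-1 < v + 3^-1 * t ^+ 2.
Proof.
move=> t01 ha [hi|[u hu]].
  (* Here 11/150 = 1/3 - 13/50 bounds the distance from the cylinder 21 to [alpha]. *)
  exists ((0 + 0 + 2 * (11 / 150) ^+ 2 + (9^-1 - t) ^+ 2 + (4 / 27 - t) ^+ 2) / 8).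
    apply: cantor_gap_distortion => //.
    + by move=> *; rewrite sqr_ge0.
    + by move=> *; rewrite sqr_ge0.
    + move=> a x /hi h x0 x1; apply: sqr_ge_gap; first lra.
      by case: h => h; [left|right]; lra.
  by have := sqr_ge0 (t - 18^-1); lra.
(* Only [u] can serve both 111 and 122, which lie 7/54 apart; the sum of squared distances is least
   at the midpoint, 7/108 from each. *)
have [c111 [c122 [p111 p122 h111 h122 cc]]] : exists c111 c122 : R,
  [/\ 0 <= c111, 0 <= c122,
  (forall a x, a \in alpha -> 0 <= x -> x <= 54^-1 -> c111 <= (x - a) ^+ 2),
  (forall a x, a \in alpha -> 4 / 27 <= x -> x <= 6^-1 -> c122 <= (x - a) ^+ 2) &
  2 * (7 / 108) ^+ 2 <= c111 + c122].
  (* As 7/75 = 13/50 - 1/6, points beyond 13/50 stay at least 7/75 from 122. If [u] is that far from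
     111 or from 122, one term suffices, since 7/75 squared exceeds twice the square of 7/108;
     otherwise [u] is the nearest point to both. *)
  have [ularge|usmall] := lerP (54^-1 + 7 / 75) u.
    exists ((7 / 75) ^+ 2), 0; split; rewrite ?sqr_ge0//; last lra.
    + move=> a x /hu h x0 x1; apply: sqr_ge_gap; first lra.
      by right; case: h => [->|h]; lra.
    + by move=> *; rewrite sqr_ge0.
  have [uu|uu] := lerP u (4 / 27 - 7 / 75).
    exists 0, ((7 / 75) ^+ 2); split; rewrite ?sqr_ge0//; last lra.
    + by move=> *; rewrite sqr_ge0.
    + move=> a x /hu h x0 x1; apply: sqr_ge_gap; first lra.
      by case: h => [->|h]; [left|right]; lra.
  exists ((u - 54^-1) ^+ 2), ((4 / 27 - u) ^+ 2); split; rewrite ?sqr_ge0//.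
  + move=> a x /hu h x0 x1; apply: sqr_ge_gap; first lra.
    by right; case: h => [->|h]; lra.
  + move=> a x /hu h x0 x1; apply: sqr_ge_gap; first lra.
    by case: h => [->|h]; [left|right]; lra.
  + by have := sqr_ge0 (u - 54^-1 - (4 / 27 - u)); nra.
exists ((c111 + c122 + 2 * 0 + (9^-1 - t) ^+ 2 + (4 / 27 - t) ^+ 2) / 8).
  by apply: cantor_gap_distortion => // *; rewrite sqr_ge0.
by have := sqr_ge0 (t - 18^-1); lra.
Qed.

End gap.

(** * Existence of a mean that makes the three outer points useless to [P1] *)

Section mixture.
Context {R : realType}.

Lemma cardfs3_lt (a b c : R) : a < b -> b < c -> #|` [fset a; b; c]%fset| = 3.
Proof.
move=> ab bc; have ac := lt_trans ab bc.
by rewrite fsetUC cardfsU1 cardfs2 !inE (gt_eqF ac) (gt_eqF bc) (lt_eqF ab).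
Qed.

Variable P1 : probability R R.
Hypothesis hP1 : is_cantor_distribution P1.
Implicit Types alpha : {fset R}.

(* On [0, 1/2] a point is at least as close as any larger one that lies beyond
   its reflection through 1/2. *)
Lemma cantor_distortion_drop alpha beta (b : R) :
  b \in beta -> (forall a, a \in alpha -> a \in beta \/ b < a /\ 1 <= a + b) ->
  (distortion P1 beta <= distortion P1 alpha)%E.
Proof.
move=> bbeta h; apply: (@ge0_le_integral_cantor _ _ hP1 (sqdist _) (sqdist _)).
- exact: measurable_sqdist.
- exact: sqdist_ge0.
- exact: measurable_sqdist.
- exact: sqdist_ge0.
move=> x x0 x1; apply: sqdist_ge => a /h[abeta|[ba ab]]; first exact: sqdist_le.
by apply: le_trans (sqdist_le _ bbeta) _; rewrite lee_fin; nra.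
Qed.

(** If no such [b] exists, [alpha] avoids the gap ]1/3 + t, 2/3 - t[, and the gap bounds contradict
    the upper bound for V_(n-3)(P1). *)
Lemma exists_cantor_mean alpha (n : nat) (d1 d2 d3 : R) :
  (5 <= n)%N -> (#|` alpha| <= n)%N ->
  d1 \in alpha -> d2 \in alpha -> d3 \in alpha -> d1 < d2 -> d2 < d3 ->
  let e := 3^-1 * ((2 / 3 - d1) ^+ 2 + (5 / 6 - d2) ^+ 2 + (1 - d3) ^+ 2) in
  e <= 288^-1 ->
  (distortion P1 alpha + e%:E <= quantization_error P1 (n - 3))%E ->
  exists2 b, b \in alpha & b < d1 /\ 1 <= d1 + b.
Proof.
move=> n5 alphan d1a d2a d3a d12 d23 e e288 hW.
have [sq1 sq2 sq3] : [/\ 0 <= (2 / 3 - d1) ^+ 2, 0 <= (5 / 6 - d2) ^+ 2 &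
  0 <= (1 - d3) ^+ 2] by rewrite !sqr_ge0.
pose t := Num.max 0 (2 / 3 - d1).
have td1 : 2 / 3 - d1 <= t by rewrite le_max lexx orbT.
have t0 : 0 <= t by rewrite le_max lexx.
have te : 3^-1 * t ^+ 2 <= e.
  by rewrite /t /e; case: (leP 0 (2 / 3 - d1)) => _; lra.
(* From t^2 / 3 <= 1/288; consequently d1 >= 5/9. *)
have t9 : t <= 9^-1 by nra.
have t01 : 0 <= t <= 9^-1 by rewrite t0.
have contra (v w : R) : (v%:E <= distortion P1 alpha)%E ->
    w < v + 3^-1 * t ^+ 2 -> (quantization_error P1 (n - 3) <= w%:E)%E -> False.
  move=> hv hw hq; have : (v%:E + e%:E <= w%:E)%E.
    by rewrite (le_trans _ hq)// (le_trans _ hW)// leeD2r.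
  by rewrite -EFinD lee_fin; lra.
apply: contrapT => hb.
(* A point inside the gap would be below [d1], and a + d1 > 1/3 + t + d1 >= 1, so it would serve as
   [b]. *)
have ha a : a \in alpha -> a <= 3^-1 + t \/ 2 / 3 - t <= a.
  move=> aalpha; have [h|h] := leP a (3^-1 + t); first by left.
  right; rewrite leNgt; apply/negP => h'; apply: hb; exists a => //.
  by split; lra.
(* For n >= 6 the bound for V_3 applies; n = 5 leaves only V_2 and needs the finer estimate. *)
move: n5; rewrite leq_eqVlt => /predU1P[n5|n6]; last first.
  have [v hv hw] := cantor_gap hP1 t01 ha.
  by exact: contra hv hw (cantor_quantization_error3 hP1 (leq_sub2r 3 n6)).
have [|v hv hw] := cantor_gap_two_means hP1 t01 ha; last first.
  by apply: contra hv hw (cantor_quantization_error2 hP1 _); rewrite -n5.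
have [hi|] := pselect (forall a, a \in alpha -> a <= 13 / 50 \/ 5 / 9 <= a).
  by left.
move=> /existsNP[b /not_implyP[balpha /not_orP[/negP b1 /negP b2]]]; right.
rewrite -ltNge in b1; rewrite -ltNge in b2.
(* Now 13/50 < b < 5/9 <= d1, so four of the at most five points exceed 13/50; the remaining one, if
   any, is [u]. *)
pose A := (alpha `\` [fset d1; d2; d3; b])%fset.
have A1 : (#|` A| <= 1)%N.
  have uniq4 : #|` [fset d1; d2; d3; b]%fset| = 4.
    rewrite fsetUC cardfsU1 !inE (cardfs3_lt d12 d23) !negb_or.
    by rewrite !lt_eqF//; lra.
  rewrite cardfsDS ?uniq4; first by rewrite leq_subLR (leq_trans alphan)// -n5.
  by apply/fsubsetP => x; rewrite !inE => /orP[/orP[/orP[]|]|] /eqP->.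
have [u hu] : exists u, forall a, a \in A -> a = u.
  have [->|[u uA]] := fset_0Vmem A; first by exists 0 => a; rewrite inE.
  exists u => a aA.
  have /eqP cA : #|` A| == 1%N.
    by rewrite eqn_leq A1 cardfs_gt0; apply/fset0Pn; exists u.
  have [y Ay] := cardfs1P _ (introT eqP cA).
  by move: uA aA; rewrite Ay !inE => /eqP-> /eqP->.
exists u => a aalpha.
have [aA|] := boolP (a \in A); first by left; exact: hu.
rewrite !inE aalpha andbT negbK => /orP[/orP[/orP[]|]|] /eqP->; right; lra.
Qed.

End mixture.

(** * Splitting an optimal set into [D] and an optimal set for [P1] *)

Theorem theorem4p7p5 (R : realType) (P1 : probability R R)
    (hP1 : is_cantor_distribution P1) (n : nat) (hn : (5 <= n)%N)
    (alpha : {fset R}) (halpha : optimal_means (half_mixture P1 P2) n alpha) :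
  (exists2 beta : {fset R},
      optimal_means P1 (n - 3) beta & alpha = (beta `|` D)%fset) /\
  quantization_error (half_mixture P1 P2) n =
    (2^-1%:E * quantization_error P1 (n - 3))%E.
Proof.
case: halpha => /andP[alpha0 alphan] optV.
set W := quantization_error P1 (n - 3).
have W0 : (0 <= W)%E by apply: quantization_error_ge => beta _; exact: distortion_ge0.
have W288 : (W <= (288^-1)%:E)%E.
  exact: (cantor_quantization_error2 hP1 (leq_sub2r 3 hn)).
have [w Ew] : exists w : R, W = w%:E.
  by exists (fine W); rewrite fineK// ge0_fin_numE// (le_lt_trans W288)// ltry.
have [d1 [d2 [d3 [d1a d2a d3a E2]]]] := distortion_P2 alpha0.
set e := 3^-1 * _ in E2.
have [sq1 sq2 sq3] : [/\ 0 <= (2 / 3 - d1) ^+ 2, 0 <= (5 / 6 - d2) ^+ 2 &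
  0 <= (1 - d3) ^+ 2] by rewrite !sqr_ge0.
have e0 : 0 <= e by rewrite /e; lra.
have V1W : (distortion P1 alpha + e%:E <= W)%E.
  have := quantization_error_half_mixture_P2 P1 (ltnW hn).
  rewrite -optV distortion_half_mixture E2 -ge0_muleDr ?lee_fin//.
  - by rewrite lee_pmul2l.
  - exact: distortion_ge0.
have [v Ev] : exists v : R, distortion P1 alpha = v%:E.
  exists (fine (distortion P1 alpha)); rewrite fineK// ge0_fin_numE ?distortion_ge0//.
  by apply: le_lt_trans (ltry w); rewrite -Ew (le_trans _ V1W)// leeDl// lee_fin.
have v0 : 0 <= v by rewrite -lee_fin -Ev distortion_ge0.
have vew : v + e <= w by rewrite -lee_fin EFinD -Ev -Ew.
have w288 : w <= 288^-1 by rewrite -lee_fin -Ew.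
have e288 : e <= 288^-1 by lra.
(* If d1 >= d2, the two errors differ by at least 1/6, so their squares sum to at least 1/72 and e
   >= 1/216 > 1/288. The same holds for [d2] and [d3]. *)
have d12 : d1 < d2.
  by move: e288; rewrite /e => e288; have := sqr_ge0 (2 / 3 - d1 + (5 / 6 - d2)); nra.
have d23 : d2 < d3.
  by move: e288; rewrite /e => e288; have := sqr_ge0 (5 / 6 - d2 + (1 - d3)); nra.
have [b balpha [bd1 d1b]] := exists_cantor_mean hP1 hn alphan d1a d2a d3a d12 d23 e288 V1W.
pose F := [fset d1; d2; d3]%fset.
pose A := (alpha `\` F)%fset.
have F3 : #|` F| = 3 by exact: cardfs3_lt.
have Falpha : (F `<=` alpha)%fset.
  by apply/fsubsetP => x; rewrite !inE => /orP[/orP[]|] /eqP->.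
have bA : b \in A.
  by rewrite !inE balpha andbT !negb_or !lt_eqF//; lra.
have cardA : (1 <= #|` A| <= n - 3)%N.
  apply/andP; split; first by rewrite cardfs_gt0; apply/fset0Pn; exists b.
  by rewrite /A cardfsDS// F3 leq_sub2r.
(* The reflection condition on [b] and [d1] passes to the larger [d2] and [d3]. *)
have distA : (distortion P1 A <= distortion P1 alpha)%E.
  apply: (cantor_distortion_drop hP1 bA) => a aalpha.
  have [aA|] := boolP (a \in A); first by left.
  rewrite !inE aalpha andbT negbK => /orP[/orP[]|] /eqP->; right; split; lra.
have WA : (W <= distortion P1 A)%E by exact: quantization_error_le.
(* Together with v + e <= w and e >= 0 this forces e = 0 and v = w. *)
have wv : w <= v by rewrite -lee_fin -Ew -Ev (le_trans WA).
have e00 : e = 0 by lra.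
have [D1 D2 D3] : [/\ d1 = 2 / 3, d2 = 5 / 6 & d3 = 1].
  have sqr_le0_eq (x y : R) : (x - y) ^+ 2 <= 0 -> y = x.
    by move=> h; apply/esym/eqP; rewrite -subr_eq0 -sqrf_eq0 eq_le h sqr_ge0.
  by move: e00; rewrite /e => e00; split; apply: sqr_le0_eq; lra.
have WV : W = distortion P1 A.
  apply/eqP; rewrite eq_le WA/= (le_trans distA)// Ev Ew lee_fin.
  by apply: le_trans vew; rewrite lerDl.
split.
  exists A; first by split.
  have -> : D = F by rewrite /D -D1 -D2 -D3.
  by rewrite fsetUDr fsetDv fsetD0; apply/esym/fsetUidPl.
rewrite -optV distortion_half_mixture E2 e00 mule0 adde0 Ev Ew.
by congr (_ * _%:E)%E; lra.
Qed.
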